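(* Let $N$ source domains and one target domain be given, with latent representation $\mathbf{z}\in\mathcal{Z}\subset\mathbb{R}^n$, and let $(r,\boldsymbol{\phi})=g(\mathbf{z})$ be the polar coordinates of $\mathbf{z}$. Suppose that $\operatorname{support}(p^t(\mathbf{z}))\subset\operatorname{support}(p(\mathbf{z}\mid D))$. If angular invariance holds, i.e. for $d=1,\dots,N$, $$p(\boldsymbol{\phi}\mid Y,D=d)=p^t(\boldsymbol{\phi}\mid Y),$$ then for $d=1,\dots,N$ the ratio $p^t(\mathbf{z}\mid Y)/p(\mathbf{z}\mid D=d,Y)$ exists and satisfies $$\frac{p^t(\mathbf{z}\mid Y)}{p(\mathbf{z}\mid D=d,Y)}=\frac{p^t(r\mid\boldsymbol{\phi},Y)}{p(r\mid\boldsymbol{\phi},D=d,Y)}.$$ (For $Y=y$ the right-hand side is denoted $w(r\mid\boldsymbol{\phi},d,y)$.)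
   Context: Setting: there are $N$ source distributions and one target distribution (superscript $t$) on an input-label space $\mathcal{X}\times\mathcal{Y}$; the source distributions are pairwise different and each differs from the target distribution. $Y$ is the class label, with $C$ classes, and $D$ is a random variable indexing the source domains: $D=d$ denotes the $d$-th source domain. The marginal distributions of all these domains on $\mathcal{X}$ are continuous. A feature extraction map $\pi:\mathcal{X}\to\mathcal{Z}\subset\mathbb{R}^n$ is fixed such that the push-forwards under $\pi$ have probability density functions on $\mathcal{Z}$: $p(\mathbf{z}\mid D=d)$ for the $d$-th source domain and $p^t(\mathbf{z})$ for the target domain. $p(\mathbf{z}\mid D=d,Y)$ and $p^t(\mathbf{z}\mid Y)$ are the corresponding conditional densities given the class label. Polar coordinates: $(r,\phi_1,\dots,\phi_{n-1})=g(z_1,\dots,z_n)$ is the (bijective) polar reparametrization of the Cartesian coordinates $\mathbf{z}=(z_1,\dots,z_n)$, with $r=\sqrt{z_1^2+\dots+z_n^2}$ and inverse $z_1=r\cos\phi_1$, $z_2=r\sin\phi_1\cos\phi_2$, ..., $z_{n-1}=r\left(\prod_{i=1}^{n-2}\sin\phi_i\right)\cos\phi_{n-1}$, $z_n=r\prod_{i=1}^{n-1}\sin\phi_i$. Write $\boldsymbol{\phi}=(\phi_1,\dots,\phi_{n-1})$. $p(\boldsymbol{\phi}\mid Y,D=d)$ and $p^t(\boldsymbol{\phi}\mid Y)$ are the conditional densities of the angular coordinates, and $p(r\mid\boldsymbol{\phi},D=d,Y)$ and $p^t(r\mid\boldsymbol{\phi},Y)$ are the conditional densities of the norm given the angles,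 so that $p(r,\boldsymbol{\phi}\mid Y,D)=p(\boldsymbol{\phi}\mid Y,D)\,p(r\mid\boldsymbol{\phi},Y,D)$, and likewise for the target.
   Formalization: Marginal support inclusion does not make the class-conditional ratio finite, so existence and equality are stated a.e. where p(z|D=d,Y) is nonzero; where it vanishes but p^t(z|Y) does not, both ratios are infinite; on the support of p^t(z) some class has p(z|D=d,Y) nonzero. *)

(* Defs.v *)
(* Written against MathComp and MathComp-Analysis. *)
From HB Require Import structures.
From mathcomp Require Export all_boot all_order all_algebra.
From mathcomp Require Export all_classical all_reals all_analysis.
Export Order.TTheory GRing.Theory Num.Theory.
Export numFieldNormedType.Exports.
Set Implicit Arguments.
Unset Strict Implicit.
Unset Printing Implicit Defensive.
Local Open Scope classical_set_scope.
Local Open Scope ring_scope.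

HB.instance Definition _ (C : nat) := isPointed.Build 'I_C.+1 ord0.

(* Class labels carry the discrete sigma-algebra, as bool and unit do in the
   library. *)
HB.instance Definition _ (C : nat) := @isMeasurable.Build
  default_measure_display 'I_C.+1 discrete_measurable discrete_measurable0
  discrete_measurableC discrete_measurableU.

(* R^n with its product sigma-algebra, which is the Borel sigma-algebra. *)
Notation Rvec R n := (n.-tuple (measurableTypeR R)).

Section lebesgue_vec.
Context {R : realType}.

Definition vec_cons n (x : measurableTypeR R * Rvec R n) : Rvec R n.+1 :=
  [the n.+1.-tuple _ of x.1 :: x.2].

Lemma measurable_vec_cons n : measurable_fun setT (@vec_cons n).
Proof. exact: measurable_cons. Qed.

Section step.
Context n (mu : {sigma_finite_measure set (Rvec R n) -> \bar R}).

Definition lebesgue_vec_step : set (Rvec R n.+1) -> \bar R :=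
  pushforward (@lebesgue_measure R \x mu)%E (@vec_cons n).

Let pre_measurable A : measurable A -> measurable (@vec_cons n @^-1` A).
Proof.
by move=> mA; rewrite -[X in measurable X]setTI; exact: measurable_vec_cons.
Qed.

Fact lebesgue_vec_step0 : lebesgue_vec_step set0 = 0%E.
Proof. by rewrite /lebesgue_vec_step /pushforward preimage_set0 measure0. Qed.

Fact lebesgue_vec_step_ge0 A : (0 <= lebesgue_vec_step A)%E.
Proof. by rewrite /lebesgue_vec_step /pushforward; exact: measure_ge0. Qed.

Fact lebesgue_vec_step_sigma_additive : semi_sigma_additive lebesgue_vec_step.
Proof.
move=> F mF tF mUF; rewrite /lebesgue_vec_step /pushforward preimage_bigcup.
apply: measure_semi_sigma_additive.
- by move=> k; exact: pre_measurable.
- apply/trivIsetP => /= i j _ _ ij; rewrite -preimage_setI.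
  by move/trivIsetP : tF => /(_ _ _ _ _ ij) ->//; rewrite preimage_set0.
- by rewrite -preimage_bigcup; exact: pre_measurable.
Qed.

HB.instance Definition _ := isMeasure.Build _ _ _ lebesgue_vec_step
  lebesgue_vec_step0 lebesgue_vec_step_ge0 lebesgue_vec_step_sigma_additive.

Fact lebesgue_vec_step_sigma_finite : sigma_finite setT lebesgue_vec_step.
Proof.
have /sigma_finiteP[F [TF ndF Foo]] := sigma_finiteT (@lebesgue_measure R).
have /sigma_finiteP[G [TG ndG Goo]] := sigma_finiteT mu.
pose u (v : Rvec R n.+1) : measurableTypeR R * Rvec R n :=
  (thead v, [tuple of behead v]).
have mfu : measurable_fun setT u.
  apply: measurable_fun_pair; first exact: measurable_tnth.
  exact: measurable_behead.
have ucons : u \o @vec_cons n = id.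
  by apply/funext => -[x v]; rewrite /u /= theadE; congr pair; exact: val_inj.
exists (fun k => u @^-1` (F k `*` G k)).
  apply/esym/seteqP; split=> // v _.
  have [i _ Fi] : (\bigcup_k F k) (u v).1 by rewrite -TF.
  have [j _ Gj] : (\bigcup_k G k) (u v).2 by rewrite -TG.
  exists (maxn i j) => //; split.
    by move: Fi; exact/subsetPset/ndF/leq_maxl.
  by move: Gj; exact/subsetPset/ndG/leq_maxr.
move=> k; have [mF Fk] := Foo k; have [mG Gk] := Goo k.
split.
  by rewrite -[X in measurable X]setTI; apply: mfu => //; exact: measurableX.
rewrite /lebesgue_vec_step /pushforward -comp_preimage ucons preimage_id.
by rewrite product_measure1E// lte_mul_pinfty// ge0_fin_numE.
Qed.

HB.instance Definition _ := Measure_isSigmaFinite.Build _ _ _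
  lebesgue_vec_step lebesgue_vec_step_sigma_finite.

End step.

(* Lebesgue measure on R^n, as an iterated product of the one-dimensional
   one; R^0 is a point of mass 1. *)
Fixpoint lebesgue_vec (n : nat) :
    {sigma_finite_measure set (Rvec R n) -> \bar R} :=
  match n with
  | 0 => \d_([tuple] : Rvec R 0)
  | k.+1 => lebesgue_vec_step (lebesgue_vec k)
  end.

End lebesgue_vec.

Section polar.
Context {R : realType} {n : nat}.

(* [angles n] is the range of (phi_1, ..., phi_(n-1)): [0, pi] for all angles
   but the last one, which ranges over [0, 2 pi[. *)
Definition angles : set (Rvec R n.-1) :=
  [set phi | forall i : 'I_n.-1, 0 <= tnth phi i /\
    if (i.+1 < n.-1)%N then tnth phi i <= pi else tnth phi i < pi *+ 2].

Definition radii : set (measurableTypeR R) := [set r | 0 <= r].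

(* The coordinates are numbered from 0 here; the last one carries no cosine. *)
Definition cartesian (w : measurableTypeR R * Rvec R n.-1) : Rvec R n :=
  [tuple w.1 * (\prod_(j < i) sin (nth 0 w.2 j)) *
         (if (i < n.-1)%N then cos (nth 0 w.2 i) else 1) | i < n].

(* Where the angles are not unique (at the origin, for instance), any measurable
   choice in [angles] is allowed; this is a Lebesgue null set. *)
Definition polar_coordinates
    (g : Rvec R n -> measurableTypeR R * Rvec R n.-1) : Prop :=
  [/\ measurable_fun setT g,
      forall z, (g z).1 = Num.sqrt (\sum_(i < n) tnth z i ^+ 2),
      forall z, angles (g z).2 &
      forall z, cartesian (g z) = z].

End polar.
Arguments angles : clear implicits.
Arguments radii : clear implicits.

Section densities.
Context {R : realType}.

(* f is a density on D, with respect to mu, of the law nu. *)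
Definition is_density d (T : measurableType d)
    (mu : {measure set T -> \bar R}) (D : set T) (nu : set T -> \bar R)
    (f : T -> R) : Prop :=
  [/\ measurable_fun D f,
      forall x, D x -> 0 <= f x &
      forall B, measurable B -> nu B = (\int[mu]_(x in D `&` B) (f x)%:E)%E].

(* q is a conditional density, given the second coordinate, of the law nu on
   T1 * T2, f being the density of the second coordinate. *)
Definition is_cond_density d1 d2 (T1 : measurableType d1)
    (T2 : measurableType d2) (mu1 : {sigma_finite_measure set T1 -> \bar R})
    (mu2 : {sigma_finite_measure set T2 -> \bar R}) (D1 : set T1) (D2 : set T2)
    (nu : set (T1 * T2) -> \bar R) (f : T2 -> R) (q : T1 -> T2 -> R) : Prop :=
  [/\ measurable_fun (D1 `*` D2) (fun x => q x.1 x.2),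
      forall x1 x2, D1 x1 -> D2 x2 -> 0 <= q x1 x2,
      {ae mu2, forall x2, D2 x2 -> f x2 != 0 ->
         (\int[mu1]_(x1 in D1) (q x1 x2)%:E = 1)%E} &
      is_density (mu1 \x mu2)%E (D1 `*` D2) nu (fun x => f x.2 * q x.1 x.2)].

Context d (X : measurableType d) (C : nat).

(* A domain is a law on X * 'I_C.+1, so there are C.+1 classes; there is at
   least one, since a probability lives on a nonempty type. *)
Implicit Types P Q : probability (X * 'I_C.+1)%type R.

Definition law P T (h : X -> T) (B : set T) : \bar R :=
  P ((h @^-1` B) `*` setT).

Definition cond_law P (y : 'I_C.+1) T (h : X -> T) (B : set T) : \bar R :=
  (P ((h @^-1` B) `*` [set y]) * ((fine (P (setT `*` [set y])))^-1)%:E)%E.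

Definition same_distribution P Q := forall A, measurable A -> P A = Q A.

Definition continuous_marginal P :=
  forall x : X, measurable [set x] -> law P id [set x] = 0%E.

Record domain_densities n := DomainDensities {
  dens_z : Rvec R n -> R;                            (* p(z) *)
  dens_zY : 'I_C.+1 -> Rvec R n -> R;                (* p(z | Y) *)
  dens_phiY : 'I_C.+1 -> Rvec R n.-1 -> R;           (* p(phi | Y) *)
  dens_rY : 'I_C.+1 -> R -> Rvec R n.-1 -> R         (* p(r | phi, Y) *)
}.

Definition densities_of n P (Z : set (Rvec R n)) (feat : X -> Rvec R n)
    (g : Rvec R n -> measurableTypeR R * Rvec R n.-1)
    (p : domain_densities n) : Prop :=
  is_density (lebesgue_vec n) Z (law P feat) (dens_z p) /\
  forall y : 'I_C.+1,
  [/\ is_density (lebesgue_vec n) Z (cond_law P y feat) (dens_zY p y),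
      is_density (lebesgue_vec n.-1) (angles R n)
        (cond_law P y (fun x => (g (feat x)).2)) (dens_phiY p y) &
      is_cond_density lebesgue_measure (lebesgue_vec n.-1)
        (radii R) (angles R n)
        (cond_law P y (fun x => g (feat x))) (dens_phiY p y) (dens_rY p y)].

(* Densities are determined up to null sets only, so the inclusion
   {f != 0} `<=` {h != 0} is taken up to a null set. *)
Definition support_sub n (Z : set (Rvec R n)) (f h : Rvec R n -> R) : Prop :=
  {ae lebesgue_vec n, forall z, Z z -> f z != 0 -> h z != 0}.

End densities.

(* Main.v *)
Require Import Defs.
From mathcomp Require Import all_boot all_order all_algebra.
From mathcomp Require Import all_classical all_reals all_analysis.
From mathcomp Require Import measurable_realfun.
Import Order.TTheory GRing.Theory Num.Theory.
Import numFieldNormedType.Exports.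
Set Implicit Arguments.
Unset Strict Implicit.
Unset Printing Implicit Defensive.
Local Open Scope classical_set_scope.
Local Open Scope ring_scope.

(* The Jacobian of the polar coordinates is never computed. Write f, f' for the
   densities of z (source, target), q, q' for the joint densities of
   (r, phi) = g(z), all given Y = y. For every measurable A, both
   int_A q'(g z) f(z) dz and int_A q(g z) f'(z) dz equal the integral of q q'
   over the set of all (r, phi) whose Cartesian point lies in A, hence
   f' * (q o g) = f * (q' o g) almost everywhere. As q = p(phi) p(r | phi),
   angular invariance cancels the angular factor; it may fail only on a set of
   angles that both laws of phi ignore. *)

(** * Weighted integrals as functions of image measures *)

Section weighted_integral.
Context {R : realType}.
Import HBNNSimple.

(** Monotone convergence along simple approximations of [h]. On the right, [f] enters only through
    its integrals over [u]-preimages, so two weights with the same image measure can be compared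
    term by term. *)
Lemma ge0_integral_weightE d1 d2 (S : measurableType d1) (T : measurableType d2)
    (mu : {measure set S -> \bar R}) (f : S -> R) (u : S -> T) (h : T -> \bar R)
    (mh : measurable_fun [set: T] h) :
  measurable_fun [set: S] f -> (forall x, 0 <= f x) -> measurable_fun [set: S] u ->
  (forall y, (0 <= h y)%E) ->
  (\int[mu]_x (h (u x) * (f x)%:E) =
   limn (fun n => \sum_(r \in range (nnsfun_approx measurableT mh n))
     (r%:E * \int[mu]_(x in u @^-1` (nnsfun_approx measurableT mh n @^-1` [set r]))
       (f x)%:E)))%E.
Proof.
move=> mf f0 mu_ h0; set h_ := nnsfun_approx measurableT mh.
have hu k : measurable_fun setT (h_ k \o u) by exact: measurableT_comp.
have -> : (\int[mu]_x (h (u x) * (f x)%:E) =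
    limn (fun n => \int[mu]_x ((h_ n (u x))%:E * (f x)%:E)))%E.
  rewrite -monotone_convergence//.
  - apply: eq_integral => x _; apply/esym/cvg_lim => //; apply: cvgeZr => //.
    exact: cvg_nnsfun_approx.
  - move=> k; apply: emeasurable_funM; apply/measurable_EFinP => //; exact: (hu k).
  - by move=> k x _; rewrite -EFinM lee_fin mulr_ge0.
  - move=> x _ m k mk; rewrite -!EFinM lee_fin ler_wpM2r//.
    exact/lefP/nd_nnsfun_approx.
congr (limn _); apply/funext => n.
under eq_integral => x _.
  rewrite (fimfunE (h_ n)) -fsumEFin//.
  rewrite ge0_mule_fsuml; last by move=> r; exact: nnfun_muleindic_ge0.
  over.
rewrite ge0_integral_fsum//; last 2 first.
- move=> r; apply: emeasurable_funM; apply/measurable_EFinP => //.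
  apply: measurable_funM => //.
  by apply: (measurableT_comp _ mu_) => //.
- move=> r x _; rewrite mule_ge0 ?lee_fin//.
  by have := nnfun_muleindic_ge0 (h_ n) r (u x); rewrite lee_fin.
apply: eq_fsbigr => r; rewrite inE => -[x _ <-].
have mA : measurable (u @^-1` (h_ n @^-1` [set h_ n x])).
  by rewrite -[X in measurable X]setTI; exact: mu_.
rewrite -ge0_integralZl_EFin//; last 2 first.
- by move=> y _; rewrite lee_fin.
- exact/measurable_funTS/measurable_EFinP.
rewrite [RHS]integral_mkcond; apply: eq_integral => y _.
rewrite /patch indicE; case: ifPn => yA.
  by rewrite mem_set ?mulr1//; move: yA; rewrite inE.
rewrite memNset ?mulr0 ?mul0e//.
by move: yA; rewrite notin_setE.
Qed.

(** The weighted measures [f mu] and [q nu] have the same image on [U], so the simple-function sums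
    of both sides coincide. *)
Lemma ge0_integral_weight_eq d1 d2 d3 (S : measurableType d1)
    (T : measurableType d2) (U : measurableType d3)
    (mu : {measure set S -> \bar R}) (nu : {measure set T -> \bar R})
    (f : S -> R) (q : T -> R) (u : S -> U) (v : T -> U) (h : U -> \bar R) :
  measurable_fun [set: S] f -> (forall x, 0 <= f x) -> measurable_fun [set: S] u ->
  measurable_fun [set: T] q -> (forall x, 0 <= q x) -> measurable_fun [set: T] v ->
  (forall B, measurable B -> (\int[mu]_(x in u @^-1` B) (f x)%:E =
                              \int[nu]_(x in v @^-1` B) (q x)%:E)%E) ->
  measurable_fun [set: U] h -> (forall y, (0 <= h y)%E) ->
  (\int[mu]_x (h (u x) * (f x)%:E) = \int[nu]_x (h (v x) * (q x)%:E))%E.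
Proof.
move=> mf f0 mu_ mq q0 mv fq mh h0.
rewrite !(ge0_integral_weightE _ mh)//; congr (limn _); apply/funext => n.
by apply: eq_fsbigr => r _; rewrite fq.
Qed.

End weighted_integral.

(** * Null sets of densities, and densities of image laws *)

Section density_facts.
Context {R : realType}.

(** Extension by zero frees the pushforward lemmas below from the domain [D]. *)
Lemma is_density_patch d (T : measurableType d)
    (mu : {measure set T -> \bar R}) (D : set T) (nu : set T -> \bar R)
    (f : T -> R) : measurable D ->
  is_density mu D nu f -> is_density mu [set: T] nu (f \_ D).
Proof.
move=> mD [mf f0 nuE]; split.
- exact/(measurable_restrictT _ mD).
- by move=> x _; rewrite /patch; case: ifPn => // /[!inE] /f0.
- move=> B mB; rewrite nuE// setTI integral_mkcondl.
  by apply: eq_integral => x _; rewrite /patch; case: ifPn.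
Qed.

Lemma is_density_null d (T : measurableType d)
    (mu : {measure set T -> \bar R}) (D : set T) (nu : set T -> \bar R)
    (f : T -> R) (B : set T) : measurable D ->
  is_density mu D nu f -> measurable B -> nu B = 0%E ->
  {ae mu, forall x, D x -> B x -> f x = 0}.
Proof.
move=> mD [mf f0 nuE] mB; rewrite nuE// => int0.
have mDB : measurable (D `&` B) by exact: measurableI.
have mF : measurable_fun (D `&` B) (EFin \o f).
  by apply/measurable_EFinP; apply: measurable_funS mf => // x [].
have /(ae_eq_integral_abs mu mDB mF) : (\int[mu]_(x in D `&` B) `|(f x)%:E| = 0)%E.
  rewrite -[RHS]int0; apply: eq_integral => x; rewrite inE => -[Dx _].
  by rewrite gee0_abs// lee_fin f0.
by apply: filterS => x fx0 Dx Bx; have [] := fx0 (conj Dx Bx).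
Qed.

Section pushforward_density.
Context d1 d2 (S : measurableType d1) (T : measurableType d2).
Context (lam : {measure set S -> \bar R}) (mu : {measure set T -> \bar R}).
Context (g : S -> T) (mg : measurable_fun [set: S] g).

(** The image law gives the zero set of [q] no mass, so [nu] ignores its preimage and [f] vanishes
    almost everywhere there. *)
Lemma density_pushforward_neq0 (nu : set S -> \bar R) (f : S -> R) (q : T -> R) :
  is_density lam [set: S] nu f ->
  is_density mu [set: T] (fun B => nu (g @^-1` B)) q ->
  {ae lam, forall z, f z != 0 -> q (g z) != 0}.
Proof.
move=> df [mq q0 nuq].
have mB : measurable (q @^-1` [set 0]) by rewrite -[X in measurable X]setTI; exact: mq.
have mgB : measurable (g @^-1` (q @^-1` [set 0])).
  by rewrite -[X in measurable X]setTI; exact: mg.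
have nu0 : nu (g @^-1` (q @^-1` [set 0])) = 0%E.
  by rewrite nuq// integral0_eq// => x [_ ->].
have := is_density_null measurableT df mgB nu0.
by apply: filterS => z fz; apply: contraNneq => qz; rewrite fz.
Qed.

Context (c : T -> S) (mc : measurable_fun [set: T] c) (gK : cancel g c).

Lemma density_pushforward_cross (nu nu' : set S -> \bar R) (f f' : S -> R)
    (q q' : T -> R) :
  is_density lam [set: S] nu f ->
  is_density mu [set: T] (fun B => nu (g @^-1` B)) q ->
  is_density lam [set: S] nu' f' ->
  is_density mu [set: T] (fun B => nu' (g @^-1` B)) q' ->
  (nu' setT < +oo)%E ->
  {ae lam, forall z, f' z * q (g z) = f z * q' (g z)}.
Proof.
move=> [mf f0 nuf] [mq q0 nuq] [mf' f'0 nuf'] [mq' q'0 nuq'] nu'oo.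
have transfer (eta : set S -> \bar R) (a : S -> R) (b h : T -> R) A :
    is_density lam [set: S] eta a ->
    is_density mu [set: T] (fun B => eta (g @^-1` B)) b ->
    measurable_fun [set: T] h -> (forall w, 0 <= h w) -> measurable A ->
    (\int[lam]_(z in A) (a z * h (g z))%:E =
     \int[mu]_(w in c @^-1` A) (b w * h w)%:E)%E.
  move=> [ma a0 etaa] [mb b0 etab] mh h0 mA.
  have mcA : measurable (c @^-1` A) by rewrite -[X in measurable X]setTI; exact: mc.
  (* The test function is [h] cut off to the preimage of [A] under [c]. As [c] undoes [g], composing
     with [g] turns the cutoff into the indicator of [A]. *)
  have mH : measurable_fun [set: T] (EFin \o h \_ (c @^-1` A)).
    apply/measurable_EFinP/(measurable_restrictT _ mcA).
    exact: measurable_funTS.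
  have H0 w : (0 <= (EFin \o h \_ (c @^-1` A)) w)%E.
    by rewrite /= lee_fin /patch; case: ifPn.
  have ab B : measurable B -> (\int[lam]_(z in g @^-1` B) (a z)%:E =
      \int[mu]_(w in id @^-1` B) (b w)%:E)%E.
    move=> mB; rewrite -[B in RHS]setTI -etab// etaa ?setTI//.
    by rewrite -[X in measurable X]setTI; exact: mg.
  have := ge0_integral_weight_eq ma (fun x => a0 x I) mg mb (fun x => b0 x I)
    (@measurable_id _ _ setT) ab mH H0.
  rewrite [LHS](_ : _ = \int[lam]_(z in A) (a z * h (g z))%:E)%E; last first.
    rewrite [RHS]integral_mkcond; apply: eq_integral => z _.
    rewrite /= /patch; have -> : (g z \in c @^-1` A) = (z \in A).
      by apply/idP/idP; rewrite !inE /= gK.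
    by case: ifPn => _; rewrite -EFinM ?mul0r// mulrC.
  move=> ->; rewrite [RHS]integral_mkcond; apply: eq_integral => w _.
  by rewrite /= /patch; case: ifPn => _; rewrite -EFinM ?mul0r// mulrC.
(* Equal integrals over all measurable sets give almost everywhere equality for an integrable
   function. On [D k] the function [f' * (q \o g)] is dominated by [k * f'], which is integrable
   because [nu'] has finite mass. *)
pose D k := g @^-1` [set w | q w <= k%:R].
have mqg : measurable_fun [set: S] (q \o g) by exact: measurableT_comp.
have mq'g : measurable_fun [set: S] (q' \o g) by exact: measurableT_comp.
have mD k : measurable (D k).
  have -> : D k = (q \o g) @^-1` `]-oo, k%:R].
    by apply/seteqP; split => z /=; rewrite in_itv.
  by rewrite -[X in measurable X]setTI; exact: mqg.
have cross k : {ae lam, forall z, D k z -> f' z * q (g z) = f z * q' (g z)}.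
  suff : ae_eq lam (D k) (fun z => (f' z * q (g z))%:E)
                         (fun z => (f z * q' (g z))%:E).
    by apply: filterS => z /[apply] -[].
  apply: integral_ae_eq => //.
  - apply: (@le_integrable _ _ _ _ _ _ _ (fun z => k%:R%:E * (f' z)%:E)%E) => //.
    + apply/measurable_EFinP/measurable_funTS; exact: measurable_funM.
    + move=> z Dz; rewrite lee_fin ger0_norm ?mulr_ge0 ?f'0 ?q0//.
      by rewrite ger0_norm ?mulr_ge0 ?f'0// mulrC ler_wpM2r ?f'0.
    + apply: integrableZl => //; apply: (@integrableS _ _ _ _ setT) => //.
      apply/integrableP; split; first exact/measurable_EFinP.
      rewrite (le_lt_trans _ nu'oo)// nuf'// setTI le_eqVlt; apply/orP; left.
      apply/eqP/eq_integral => z _; by rewrite gee0_abs// lee_fin f'0.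
  - apply/measurable_EFinP/measurable_funTS; exact: measurable_funM.
  (* [transfer] is used with [h] equal to [q] on the left and to [q'] on the right; both sides
     become the integral of [q * q']. *)
  - move=> A _ mA; rewrite (transfer nu' _ q')//; last by move=> w; exact: q0.
    rewrite (transfer nu _ q)//; last by move=> w; exact: q'0.
    by apply: eq_integral => w _; rewrite mulrC.
have := ae_foralln cross.
apply: filterS => z /(_ (Num.truncn (q (g z))).+1); apply.
by rewrite /D /= ltW// truncnS_gt.
Qed.

End pushforward_density.
End density_facts.

(** The exceptional set of [Q] is [mu]-null, so the image law, having a density, gives it no mass;
    hence [f] vanishes almost everywhere on its preimage. This carries angular invariance from
    angles back to [z]. *)
Lemma density_ae_comp (R : realType) d1 d2 (S : measurableType d1)
    (T : measurableType d2) (lam : {measure set S -> \bar R})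
    (mu : {measure set T -> \bar R}) (D : set S) (E : set T) (g : S -> T)
    (nu : set S -> \bar R) (f : S -> R) (q : T -> R) (Q : T -> Prop) :
  measurable D -> measurable E -> measurable_fun [set: S] g ->
  is_density lam D nu f -> is_density mu E (fun B => nu (g @^-1` B)) q ->
  {ae mu, forall w, Q w} ->
  {ae lam, forall z, D z -> f z != 0 -> Q (g z)}.
Proof.
move=> mD mE mg df [mq q0 nuq] [B [mB B0 QB]].
have mgB : measurable (g @^-1` B) by rewrite -[X in measurable X]setTI; exact: mg.
have nu0 : nu (g @^-1` B) = 0%E.
  have mEB : measurable (E `&` B) by exact: measurableI.
  rewrite nuq// null_set_integral//.
    by apply/measurable_EFinP; apply: measurable_funS mq => // x [].
  by apply/eqP; rewrite -measure_le0 -B0 le_measure ?inE// => x [].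
have := is_density_null mD df mgB nu0.
apply: filterS => z fz Dz; apply: contra_neqP => nQ; apply: fz => //.
exact: QB.
Qed.

(** * Measurability of the Cartesian map and of the ranges of radius and angles *)

Section polar_measurability.
Context {R : realType}.

Lemma measurable_nth n (x0 : R) j :
  measurable_fun [set: Rvec R n] (fun v : Rvec R n => nth x0 v j : measurableTypeR R).
Proof.
have [jn|nj] := ltnP j n.
  have := @measurable_tnth _ (measurableTypeR R) n (Ordinal jn).
  by congr measurable_fun; apply/funext => v; rewrite (tnth_nth x0).
(* Past the end of the tuple, [nth] returns its default, a constant. *)
have -> : (fun v : Rvec R n => nth x0 v j : measurableTypeR R) = cst x0.
  by apply/funext => v; rewrite nth_default// size_tuple.
exact: measurable_cst.
Qed.

Lemma measurable_cartesian n : measurable_fun setT (@cartesian R n).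
Proof.
apply/measurable_fun_tnthP => i.
have mnth j : measurable_fun [set: measurableTypeR R * Rvec R n.-1]
    (fun w => nth 0 w.2 j : measurableTypeR R).
  exact: (measurableT_comp (measurable_nth 0 j) measurable_snd).
rewrite [X in measurable_fun _ X](_ : _ =
    fun w : measurableTypeR R * Rvec R n.-1 => w.1 * (\prod_(j < i) sin (nth 0 w.2 j)) *
         (if (i < n.-1)%N then cos (nth 0 w.2 i) else 1)); last first.
  by apply/funext => w; rewrite /= tnth_mktuple.
apply: measurable_funM; first apply: measurable_funM.
- exact: measurable_fst.
- apply: measurable_prod => j _.
  apply: (measurableT_comp _ (mnth j)).
  apply: continuous_measurable_fun; exact: continuous_sin.
- case: (i < n.-1)%N; last exact: measurable_cst.
  apply: (measurableT_comp _ (mnth i)).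
  apply: continuous_measurable_fun; exact: continuous_cos.
Qed.

Lemma measurable_angles n : measurable (angles R n).
Proof.
pose bound (i : 'I_n.-1) : set R := `[0, +oo[%classic `&`
  (if (i.+1 < n.-1)%N then `]-oo, pi]%classic else `]-oo, (pi *+ 2)[%classic).
have -> : angles R n = \bigcap_(i in [set: 'I_n.-1])
    ((fun phi : Rvec R n.-1 => tnth phi i) @^-1` bound i).
  apply/seteqP; split => [phi aphi i _|phi aphi i].
    by have := aphi i; rewrite /bound; case: ifP => _ /= []; rewrite !in_itv /= andbT.
  by have := aphi i I; rewrite /bound; case: ifP => _ /= []; rewrite !in_itv /= andbT.
apply: fin_bigcap_measurable => // i _.
rewrite -[X in measurable X]setTI; apply: (measurable_tnth i) => //.
by apply: measurableI; [|case: ifP => _]; exact: measurable_itv.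
Qed.

Lemma measurable_radii : measurable (radii R).
Proof.
have -> : radii R = `[0, +oo[%classic.
  by apply/seteqP; split => r; rewrite /= in_itv /= andbT.
exact: measurable_itv.
Qed.

End polar_measurability.

(** * From the laws given the class to the marginal law *)

Section class_laws.
Context {R : realType} d (X : measurableType d) (C : nat).
Implicit Type P : probability (X * 'I_C.+1)%type R.

Lemma cond_law_lty P y T (h : X -> T) : measurable (h @^-1` setT) ->
  (cond_law P y h setT < +oo)%E.
Proof.
move=> mh; rewrite /cond_law -(@fineK _ (P _)) -?EFinM ?ltry//.
by apply: fin_num_measure; exact: measurableX.
Qed.

(** The event is a finite union over the classes. Each piece is null because the factor dividing by
    the class probability is nonzero. *)
Lemma law_eq0 P T (h : X -> T) (B : set T) : measurable (h @^-1` B) ->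
  (forall y : 'I_C.+1, 0 < P (setT `*` [set y]))%E ->
  (forall y, cond_law P y h B = 0%E) -> law P h B = 0%E.
Proof.
move=> mB Py0 nu0; rewrite /law.
apply/negligibleP; first exact: measurableX.
have : {ae P, forall w, forall y, ~ (((h @^-1` B) `*` [set y]) w)}.
  apply: filter_forall => y; rewrite /prop_near1 /nbhs /= /almost_everywhere.
  rewrite (_ : ~` _ = (h @^-1` B) `*` [set y]); last first.
    by apply/seteqP; split => w /=; [move/contrapT|move=> ? /(_ _)].
  have mBy : measurable ((h @^-1` B) `*` [set y]) by exact: measurableX.
  apply/negligibleP => //; have /eqP := nu0 y; rewrite /cond_law mule_eq0.
  case/orP => [/eqP//|]; rewrite eqe invr_eq0 fine_eq0.
    by rewrite gt_eqF.
  by apply: fin_num_measure; exact: measurableX.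
rewrite /prop_near1 /nbhs /= /almost_everywhere.
apply: negligibleS => w [Bw _] /(_ w.2); exact.
Qed.

End class_laws.

Theorem theorem1 (R : realType) (dX : measure_display) (X : measurableType dX)
    (N C n : nat) (n_gt1 : (1 < n)%N)
    (P : 'I_N -> probability (X * 'I_C.+1)%type R)
    (Pt : probability (X * 'I_C.+1)%type R)
    (P_neq : forall d d', d != d' -> ~ same_distribution (P d) (P d'))
    (P_neq_Pt : forall d, ~ same_distribution (P d) Pt)
    (P_cont : forall d, continuous_marginal (P d))
    (Pt_cont : continuous_marginal Pt)
    (P_class : forall d (y : 'I_C.+1), (0 < P d (setT `*` [set y]))%E)
    (Pt_class : forall y : 'I_C.+1, (0 < Pt (setT `*` [set y]))%E)
    (Z : set (Rvec R n)) (mZ : measurable Z)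
    (feat : X -> Rvec R n) (mfeat : measurable_fun setT feat)
    (featZ : forall x, Z (feat x))
    (g : Rvec R n -> measurableTypeR R * Rvec R n.-1)
    (g_polar : polar_coordinates g)
    (p : 'I_N -> domain_densities (R := R) C n)
    (pt : domain_densities (R := R) C n)
    (p_dens : forall d, densities_of (P d) Z feat g (p d))
    (pt_dens : densities_of Pt Z feat g pt)
    (supp : forall d, support_sub Z (dens_z pt) (dens_z (p d)))
    (angular_invariance : forall d y, {ae lebesgue_vec n.-1, forall phi,
       angles R n phi -> dens_phiY (p d) y phi = dens_phiY pt y phi}) :
  forall d : 'I_N,
    (* at almost every point of the support of p^t(z), the ratio has a nonzero
       denominator for at least one class *)
    {ae lebesgue_vec n, forall z, Z z -> dens_z pt z != 0 ->
       exists y, dens_zY (p d) y z != 0} /\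
    forall y : 'I_C.+1,
      (* wherever p(z | D = d, Y = y) does not vanish, both ratios exist and
         are equal *)
      {ae lebesgue_vec n, forall z, Z z -> dens_zY (p d) y z != 0 ->
         let: (r, phi) := g z in
         dens_rY (p d) y r phi != 0 /\
         dens_zY pt y z / dens_zY (p d) y z
           = dens_rY pt y r phi / dens_rY (p d) y r phi} /\
      (* where only p(z | D = d, Y = y) vanishes, both ratios are +oo *)
      {ae lebesgue_vec n, forall z, Z z ->
         dens_zY (p d) y z = 0 -> dens_zY pt y z != 0 ->
         let: (r, phi) := g z in
         dens_rY (p d) y r phi = 0 /\ dens_rY pt y r phi != 0}.

Proof.
move=> d; have [mg g1 g2 gK] := g_polar.
have mphi : measurable_fun [set: Rvec R n] (fun z => (g z).2).
  exact: (measurableT_comp measurable_snd mg).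
have mE : measurable (radii R `*` angles R n).
  by apply: measurableX; [exact: measurable_radii|exact: measurable_angles].
have gE z : (radii R `*` angles R n) (g z).
  by split; [rewrite /radii /= g1 sqrtr_ge0|exact: g2].
have feat_pre B : measurable B -> measurable (feat @^-1` B).
  by move=> mB; rewrite -[X in measurable X]setTI; exact: mfeat.
have [pz pY] := p_dens d; have [ptz ptY] := pt_dens.
split.
  (* On [B] all class-conditional densities, extended by zero, vanish. Every class law, hence the
     marginal, ignores [B], so the source density of [z] is zero almost everywhere on [B] within
     [Z]; the support inclusion then excludes such points. *)
  pose B : set (Rvec R n) :=
    \bigcap_(y in [set: 'I_C.+1]) (dens_zY (p d) y \_ Z) @^-1` [set 0].
  have mB : measurable B.
    apply: fin_bigcap_measurable => // y _.
    have [/(is_density_patch mZ)[mfy _ _] _ _] := pY y.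
    by rewrite -[X in measurable X]setTI; exact: mfy.
  have nuB0 : law (P d) feat B = 0%E.
    apply: law_eq0 => //; first exact: feat_pre.
    move=> y; have [/(is_density_patch mZ)[_ _ ->//] _ _] := pY y.
    by apply: integral0_eq => z [_ /(_ y I)] /= ->.
  have := is_density_null mZ pz mB nuB0.
  have := supp d; rewrite /support_sub; apply: filterS2 => z ptp pB Zz /(ptp Zz) pz0.
  apply: contrapT => /forallNP noy; move/eqP: pz0; apply; apply: pB => // y _ /=.
  by rewrite /patch mem_set//; have /negP/negPn/eqP := noy y.
move=> y; have [fz fphi [_ _ _ fr]] := pY y; have [ftz ftphi [_ _ _ ftr]] := ptY y.
have Pt_lty : (cond_law Pt y feat setT < +oo)%E.
  by apply: cond_law_lty; exact: feat_pre.
have dz := is_density_patch mZ fz; have dtz := is_density_patch mZ ftz.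
have dr := is_density_patch mE fr; have dtr := is_density_patch mE ftr.
(* Preimages under [g (feat x)] are by computation [feat]-preimages of [g]-preimages, so the polar
   laws are image laws as they stand. *)
have cross := density_pushforward_cross mg (@measurable_cartesian R n) gK
  dz dr dtz dtr Pt_lty.
have q_neq0 := density_pushforward_neq0 mg dz dr.
have qt_neq0 := density_pushforward_neq0 mg dtz dtr.
(* Angular invariance is pulled back twice: to where the source density is nonzero and to where the
   target density is, one for each remaining claim. *)
have phi_eq := density_ae_comp mZ (@measurable_angles R n) mphi fz fphi
  (angular_invariance d y).
have phit_eq := density_ae_comp mZ (@measurable_angles R n) mphi ftz ftphi
  (angular_invariance d y).
split.
  move: cross q_neq0 phi_eq; apply: filterS3 => z + + + Zz pz0.
  rewrite /patch !(mem_set Zz) !(mem_set (gE z)) => cr /(_ pz0).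
  move=> + /(_ Zz pz0 (g2 z)); case: (g z) cr => r phi /= cr.
  (* The joint source density is nonzero, so both its factors are; cross-multiplying and restoring
     the common angular factor leaves [cr]. *)
  rewrite mulf_eq0 negb_or => /andP[phi0 r0] phiE; split => //.
  apply/eqP; rewrite eqr_div//; apply/eqP; apply: (mulfI phi0).
  by rewrite mulrCA cr -phiE mulrCA [X in _ * X]mulrC.
move: cross qt_neq0 phit_eq; apply: filterS3 => z + + + Zz pz0 ptz0.
rewrite /patch !(mem_set Zz) !(mem_set (gE z)) => cr /(_ ptz0).
move=> + /(_ Zz ptz0 (g2 z)); case: (g z) cr => r phi /= cr.
rewrite mulf_eq0 negb_or => /andP[phi0 r0] phiE; split => //.
(* The right side of [cr] is now zero; on the left the target density and the shared angular factor
   are nonzero, so the radial source density must vanish. *)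
move/eqP: cr; rewrite pz0 mul0r phiE !mulf_eq0 (negbTE ptz0) (negbTE phi0) /=.
by move/eqP.
Qed.
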